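(* Let $D$ be an integral domain and $\star$ a semistar operation on $D$ with $\widetilde{\star}\text{-}\dim(D)<\infty$. If $D$ satisfies the $\widetilde{\star}$-dimension inequality formula, then $D$ is a $\widetilde{\star}$-Jaffard domain, i.e. $\widetilde\star\text{-}\dim(D)=\widetilde\star\text{-}\dim_v(D)<\infty$.
   Context: $D$ is an integral domain with quotient field $K$; $f(D)$ denotes nonzero finitely generated fractional ideals, $\overline{\mathcal F}(D)$ nonzero $D$-submodules of $K$. A semistar operation $\star$ on $D$ is a map $\overline{\mathcal F}(D)\to\overline{\mathcal F}(D)$ with $(xE)^\star=xE^\star$ ($0\neq x\in K$), $E\subseteq F\Rightarrow E^\star\subseteq F^\star$, $E\subseteq E^\star=(E^\star)^\star$. $E^{\star_f}:=\bigcup\{F^\star:F\in f(D),F\subseteq E\}$. A nonzero ideal $I$ is a quasi-$\star$-ideal if $I^\star\cap D=I$; quasi-$\star$-primes/quasi-$\star$-maximal ideals are the prime ones / maximal proper ones; sets $\operatorname{QSpec}^\star(D)$, $\operatorname{QMax}^\star(D)$. $E^{\widetilde\star}:=\bigcap\{ED_M:M\in\operatorname{QMax}^{\star_f}(D)\}$ ($=K$ if empty). $\star$-$\operatorname{ht}(P)$: supremum of lengths of chains of quasi-$\star$-primes from $(0)$ to $P$ ($\star$-$\operatorname{ht}(0)=0$); $\star$-$\dim(D):=\sup\{\star$-$\operatorname{ht}(P):P\in\operatorname{QSpec}^\star(D)\}$ ($0$ if there are none); $\widetilde\star$-$\dim(D)=\sup\{\operatorname{ht}P:P\in\operatorname{QSpec}^{\widetilde\star}(D)\}$.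 A valuation overring $V$ of $D$ is a $\star$-valuation overring if $F^\star\subseteq FV$ for all $F\in f(D)$; $\star$-$\dim_v(D):=\sup\{\dim V\}$ over $\star$-valuation overrings. $D$ is $\star$-Jaffard if $\star$-$\dim(D)=\star$-$\dim_v(D)<\infty$. $D$ satisfies the $\widetilde\star$-dimension inequality formula if for every domain $T\supseteq D$ finitely generated as a $D$-algebra and every nonzero prime $Q$ of $T$ with $(Q\cap D)^{\widetilde\star}\subsetneq D^{\widetilde\star}$, $\operatorname{ht}(Q)+\operatorname{tr.deg}_{\mathbb K(Q\cap D)}\mathbb K(Q)\le\widetilde\star$-$\operatorname{ht}(Q\cap D)+\operatorname{tr.deg}_D(T)$, where $\mathbb K(P)=D_P/PD_P$ and $\operatorname{tr.deg}_D(T)$ is the transcendence degree of quotient fields. *)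

(* Defs.v *)
From HB Require Import structures.
From mathcomp Require Import all_boot all_order all_algebra.
From Stdlib Require Lists.List.
Set Implicit Arguments. Unset Strict Implicit. Unset Printing Implicit Defensive.
Import Order.TTheory GRing.Theory Num.Theory.
Local Open Scope ring_scope.

Definition subs (T : Type) (A B : T -> Prop) := forall x, A x -> B x.
Definition seteq (T : Type) (A B : T -> Prop) := forall x, A x <-> B x.
Definition ssubs (T : Type) (A B : T -> Prop) := subs A B /\ exists x, B x /\ ~ A x.

Fixpoint schain (T : Type) (l : seq (T -> Prop)) : Prop :=
  match l with
  | a :: ((b :: _) as t) => ssubs a b /\ schain t
  | _ => True
  end.

(* n is an upper bound of a set of naturals / n is its supremum
   (sup of the empty set is 0, as in the paper's conventions) *)
Definition isUB (S : nat -> Prop) (n : nat) := forall m, S m -> (m <= n)%N.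
Definition isSup (S : nat -> Prop) (n : nat) :=
  isUB S n /\ forall k, isUB S k -> (n <= k)%N.

Section Rings.
Variable A : fieldType.

Definition subring (R : A -> Prop) :=
  R 0 /\ R 1 /\ (forall x y, R x -> R y -> R (x + y)) /\
  (forall x, R x -> R (- x)) /\ (forall x y, R x -> R y -> R (x * y)).

Definition ideal_of (R P : A -> Prop) :=
  subs P R /\ P 0 /\ (forall x y, P x -> P y -> P (x + y)) /\
  (forall r x, R r -> P x -> P (r * x)).

Definition prime_of (R P : A -> Prop) :=
  ideal_of R P /\ ~ P 1 /\
  (forall a b, R a -> R b -> P (a * b) -> P a \/ P b).

Definition zeroset : A -> Prop := fun x => x = 0.

(* n belongs to the set whose sup is ht(P): chains P_0 < ... < P_n = P of primes *)
Definition ht_chain (R P : A -> Prop) (n : nat) :=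
  exists l : seq (A -> Prop), size l = n /\ List.Forall (prime_of R) l /\
    schain (rcons l P).

(* n belongs to the set whose sup is dim(R): chains P_0 < ... < P_n of primes *)
Definition kdim_chain (R : A -> Prop) (n : nat) :=
  exists l : seq (A -> Prop), size l = n.+1 /\ List.Forall (prime_of R) l /\
    schain l.

Definition loc (R S : A -> Prop) : A -> Prop :=
  fun x => exists a b, R a /\ R b /\ ~ S b /\ x = a / b.
Definition locid (R S : A -> Prop) : A -> Prop :=
  fun x => exists a b, S a /\ R b /\ ~ S b /\ x = a / b.

Definition fracset (R : A -> Prop) : A -> Prop :=
  fun x => exists a b, R a /\ R b /\ b != 0 /\ x = a / b.

Definition prodset (X Y : A -> Prop) : A -> Prop :=
  fun x => exists ps : seq (A * A),
    (forall p, p \in ps -> X p.1 /\ Y p.2) /\ x = \sum_(p <- ps) p.1 * p.2.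

(* a polynomial in n variables is a finite list of terms (coefficient,
   exponent vector); its value at xs is computed by peval. *)
Definition mono (xs : seq A) (e : seq nat) : A :=
  \prod_(i < size xs) xs`_i ^+ (nth 0%N e i).
Definition peval (xs : seq A) (ts : seq (A * seq nat)) : A :=
  \sum_(t <- ts) t.1 * mono xs t.2.

Definition alg_indep (k : A -> Prop) (xs : seq A) :=
  forall ts : seq (A * seq nat),
    (forall t, t \in ts -> k t.1 /\ size t.2 = size xs) ->
    uniq (map snd ts) ->
    peval xs ts = 0 ->
    forall t, t \in ts -> t.1 = 0.

(* n belongs to the set whose sup is tr.deg_k(E):
   n elements of E algebraically independent over k *)
Definition trdeg_fam (k E : A -> Prop) (n : nat) :=
  exists xs : seq A, size xs = n /\ (forall x, x \in xs -> E x) /\ alg_indep k xs.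

End Rings.

Section Semistar.
Variables (K : fieldType) (D : K -> Prop).

Definition setT' : K -> Prop := fun _ => True.

Definition domain_with_qf :=
  subring D /\ forall x : K, exists a b, D a /\ D b /\ b != 0 /\ x = a / b.

Definition submod (E : K -> Prop) :=
  E 0 /\ (forall x y, E x -> E y -> E (x + y)) /\
  (forall d x, D d -> E x -> E (d * x)) /\ exists x, E x /\ x != 0.

Definition fgen (xs : seq K) : K -> Prop :=
  fun x => exists ds : seq K, size ds = size xs /\ (forall d, d \in ds -> D d) /\
    x = \sum_(i < size xs) ds`_i * xs`_i.
Definition fin_frac (F : K -> Prop) :=
  exists xs : seq K, (exists x, x \in xs /\ x != 0) /\ seteq F (fgen xs).

Definition scale (x : K) (E : K -> Prop) : K -> Prop :=
  fun y => exists e, E e /\ y = x * e.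

Definition semistar (star : (K -> Prop) -> (K -> Prop)) :=
  (forall E, submod E -> submod (star E)) /\
  (forall x E, x != 0 -> submod E -> seteq (star (scale x E)) (scale x (star E))) /\
  (forall E F, submod E -> submod F -> subs E F -> subs (star E) (star F)) /\
  (forall E, submod E -> subs E (star E)) /\
  (forall E, submod E -> seteq (star (star E)) (star E)).

Definition star_f (star : (K -> Prop) -> (K -> Prop)) (E : K -> Prop) : K -> Prop :=
  fun x => exists F, fin_frac F /\ subs F E /\ star F x.

Definition qideal (star : (K -> Prop) -> (K -> Prop)) (I : K -> Prop) :=
  ideal_of D I /\ (exists x, I x /\ x != 0) /\ seteq (fun x => star I x /\ D x) I.
Definition qprime star I := qideal star I /\ prime_of D I.
Definition qmax star (M : K -> Prop) :=
  qideal star M /\ ~ M 1 /\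
  forall J, qideal star J -> ~ J 1 -> subs M J -> subs J M.

(* E^{~star} = intersection of E D_M over M in QMax^{star_f}(D)  (= K if none) *)
Definition stilde (star : (K -> Prop) -> (K -> Prop)) (E : K -> Prop) : K -> Prop :=
  fun x => forall M, qmax (star_f star) M -> prodset E (loc D M) x.

(* n in the set whose sup is star-ht(P): chains (0) < P_1 < ... < P_n = P of
   quasi-star-primes (n = 0 iff P = (0)) *)
Definition star_ht_chain star (P : K -> Prop) (n : nat) :=
  exists l : seq (K -> Prop), size l = n /\ List.Forall (qprime star) l /\
    schain (@zeroset K :: l) /\ seteq (last (@zeroset K) l) P.

(* n in the set whose sup is star-dim(D) = sup_P star-ht(P) *)
Definition star_dim_chain star (n : nat) :=
  exists l : seq (K -> Prop), size l = n /\ List.Forall (qprime star) l /\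
    schain (@zeroset K :: l).

Definition val_overring (V : K -> Prop) :=
  subring V /\ subs D V /\ forall x, x != 0 -> V x \/ V x^-1.
Definition star_val_overring star V :=
  val_overring V /\ forall F, fin_frac F -> subs (star F) (prodset F V).
Definition star_dimv_chain star (n : nat) :=
  exists V, star_val_overring star V /\ kdim_chain V n.

Definition star_Jaffard star :=
  exists n, isSup (star_dim_chain star) n /\ isSup (star_dimv_chain star) n.

(* The ~star-dimension inequality formula.
   A domain T ⊇ D finitely generated as a D-algebra is presented as the
   D-subalgebra D[g] of some field L into which K embeds via iota (L may be
   taken to be the quotient field of T).  The residue field K(Q) = T_Q/QT_Q is
   given by any field F with a surjective ring map rho : T_Q -> F with kernel
   QT_Q; K(Q ∩ D) is then the subfield rho(D_{Q∩D}) of F. *)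
Definition DInequality (star : (K -> Prop) -> (K -> Prop)) :=
  let tst := stilde star in
  forall (L : fieldType) (iota : {rmorphism K -> L}) (g : seq L),
  let T : L -> Prop := fun x => exists ts : seq (L * seq nat),
      (forall t, t \in ts -> exists d, D d /\ t.1 = iota d) /\ x = peval g ts in
  forall Q : L -> Prop, prime_of T Q -> (exists x, Q x /\ x != 0) ->
  let P : K -> Prop := fun y => D y /\ Q (iota y) in
  ssubs (tst P) (tst D) ->
  forall (F : fieldType) (rho : L -> F),
    (forall x y, loc T Q x -> loc T Q y ->
        rho (x + y) = rho x + rho y /\ rho (x * y) = rho x * rho y) ->
    rho 1 = 1 ->
    (forall z, exists x, loc T Q x /\ rho x = z) ->
    (forall x, loc T Q x -> (rho x = 0 <-> locid T Q x)) ->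
  let kP : F -> Prop := fun z => exists y, loc D P y /\ z = rho (iota y) in
  let iK : L -> Prop := fun z => exists y, z = iota y in
  (* ht(Q) + trdeg_{K(P)} K(Q) <= ~star-ht(P) + trdeg_D(T), in N ∪ {oo} *)
  forall a b c e,
    ht_chain T Q a -> trdeg_fam kP (fun _ => True) b ->
    isUB (star_ht_chain tst P) c -> isUB (trdeg_fam iK (fracset T)) e ->
    (a + b <= c + e)%N.

End Semistar.

(* Main.v *)
(** Localizing at a prime of D inside a quasi-maximal ideal shows that a valuation
ring of K extending a chain of quasi-primes of D is a valuation overring for the
stable operation; Chevalley's extension theorem, applied successively to the
rings D + m_i, produces such an extension of any chain, so the valuative
dimension is at least the dimension. Conversely, a chain of n + 1 primes in a
valuation overring V stays strict after contraction to the D-algebra T generated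
by n elements of V separating its members. As T and D have the same quotient
field, the dimension inequality formula at the last contracted prime, with the
transcendence degrees bounded below and above by 0, gives n <= dim. Its
hypothesis, that the center of V on D does not blow up, holds because the
stable operation is of finite type. *)
Require Import Defs.
From HB Require Import structures.
From mathcomp Require Import all_boot all_order all_algebra.
From mathcomp Require Import boolp classical_sets.
From mathcomp Require Import ring.
From mathcomp Require Import zify.
Set Implicit Arguments. Unset Strict Implicit. Unset Printing Implicit Defensive.
Import GRing.Theory.
Local Open Scope ring_scope.

(** * Residue fields *)

Section ResidueField.
Variable K : fieldType.

Record local_ring := LocalRing {
  lring : K -> Prop;
  lmax : K -> Prop;
  lring_subring : subring lring;
  lmax_ideal : ideal_of lring lmax;
  lmax1 : ~ lmax 1;
  lring_inv : forall x, lring x -> ~ lmax x -> lring x^-1 }.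

Variable R : local_ring.
Notation O := (lring R).
Notation M := (lmax R).

(** Canonical representative of the coset of [x] modulo [M], for [x] in [O]. As [choose] then
    depends only on the coset, the residue field can be carried by the subtype of [K] formed by
    these representatives. *)
Definition residue_rep (x : K) : K :=
  choose (fun y => `[< O y /\ M (y - x) >]) x.

Definition residue : Type :=
  {x : K | `[< O x >] && (residue_rep x == x)}.
HB.instance Definition _ := Choice.on residue.

Let O0 : O 0. Proof. by have [] := lring_subring R. Qed.
Let O1 : O 1. Proof. by have [_ []] := lring_subring R. Qed.
Let OD x y : O x -> O y -> O (x + y).
Proof. by have [_ [_ [h _]]] := lring_subring R; exact: h. Qed.
Let ON x : O x -> O (- x).
Proof. by have [_ [_ [_ [h _]]]] := lring_subring R; exact: h. Qed.
Let OM x y : O x -> O y -> O (x * y).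
Proof. by have [_ [_ [_ [_ h]]]] := lring_subring R; exact: h. Qed.
Let M0 : M 0. Proof. by have [_ []] := lmax_ideal R. Qed.
Let MD x y : M x -> M y -> M (x + y).
Proof. by have [_ [_ [h _]]] := lmax_ideal R; exact: h. Qed.
Let MM x y : O x -> M y -> M (x * y).
Proof. by have [_ [_ [_ h]]] := lmax_ideal R; exact: h. Qed.
Let MN x : M x -> M (- x).
Proof. by move=> Mx; rewrite -mulN1r; apply: MM => //; apply: ON. Qed.

Let rep_spec x : O x -> O (residue_rep x) /\ M (residue_rep x - x).
Proof.
move=> Ox; apply/asboolP; apply: (chooseP (P := fun y => `[< O y /\ M (y - x) >])).
by apply/asboolP; rewrite subrr.
Qed.

Let rep_eq x y : O x -> O y -> M (x - y) -> residue_rep x = residue_rep y.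
Proof.
move=> Ox Oy Mxy; rewrite /residue_rep.
(* Congruent elements define the same coset predicate, and [choose_id] then exchanges the default
   [x] for [y], both being in the coset. *)
rewrite (@eq_choose _ _ (fun z => `[< O z /\ M (z - y) >])); last first.
  move=> z; apply/asbool_equiv_eq; split=> -[Oz Mz]; split=> //.
    have -> : z - y = (z - x) + (x - y) by ring.
    exact: MD.
  have -> : z - x = (z - y) + - (x - y) by ring.
  by apply: MD => //; apply: MN.
by apply: choose_id; apply/asboolP; rewrite ?subrr.
Qed.

Let rep_in x : O x -> `[< O (residue_rep x) >] && (residue_rep (residue_rep x) == residue_rep x).
Proof.
move=> Ox; have [Or Mr] := rep_spec Ox.
by apply/andP; split; [apply/asboolP | apply/eqP; apply: rep_eq].
Qed.

(** Total on [K], like the map [rho] of [DInequality]; elements outside [O] are sent to the class of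
    0. *)
Definition residue_pi (x : K) : residue :=
  match pselect (O x) with
  | left Ox => exist _ (residue_rep x) (rep_in Ox)
  | right _ => exist _ (residue_rep 0) (rep_in O0)
  end.
Notation pi := residue_pi.

Let val_pi x : O x -> val (pi x) = residue_rep x.
Proof. by rewrite /residue_pi; case: pselect. Qed.

Let val_in (u : residue) : O (val u).
Proof. by case: u => x /= /andP[/asboolP]. Qed.

Let val_K (u : residue) : pi (val u) = u.
Proof.
apply: val_inj; rewrite val_pi //; case: u => x /= /andP[_ /eqP]; exact.
Qed.

Lemma residue_piP x y : O x -> O y -> pi x = pi y <-> M (x - y).
Proof.
move=> Ox Oy; split=> [e | Mxy]; last first.
  by apply: val_inj; rewrite !val_pi //; apply: rep_eq.
have := congr1 val e; rewrite !val_pi // => e'.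
have [_ h1] := rep_spec Ox; have [_ h2] := rep_spec Oy.
have -> : x - y = (residue_rep y - y) - (residue_rep x - x) by rewrite e'; ring.
by apply: MD => //; apply: MN.
Qed.

Lemma residue_pi_surj (u : residue) : exists x, O x /\ pi x = u.
Proof. by exists (val u); rewrite val_K. Qed.

Definition residue_add (u v : residue) := pi (val u + val v).
Definition residue_mul (u v : residue) := pi (val u * val v).
Definition residue_opp (u : residue) := pi (- val u).
Definition residue_inv (u : residue) :=
  if u == pi 0 then pi 0 else pi (val u)^-1.

Let Mval x : O x -> M (val (pi x) - x).
Proof. by move=> Ox; rewrite val_pi //; case: (rep_spec Ox). Qed.

Let addE x y : O x -> O y -> residue_add (pi x) (pi y) = pi (x + y).
Proof.
move=> Ox Oy; apply/residue_piP; [exact: OD | exact: OD |].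
have -> : val (pi x) + val (pi y) - (x + y) =
  (val (pi x) - x) + (val (pi y) - y) by ring.
by apply: MD; apply: Mval.
Qed.

Let mulE x y : O x -> O y -> residue_mul (pi x) (pi y) = pi (x * y).
Proof.
move=> Ox Oy; apply/residue_piP; [exact: OM | exact: OM |].
have -> : val (pi x) * val (pi y) - (x * y) =
  val (pi y) * (val (pi x) - x) + x * (val (pi y) - y) by ring.
by apply: MD; apply: MM => //; apply: Mval.
Qed.

Let oppE x : O x -> residue_opp (pi x) = pi (- x).
Proof.
move=> Ox; apply/residue_piP; [exact: ON | exact: ON |].
have -> : - val (pi x) - (- x) = - (val (pi x) - x) by ring.
by apply: MN; apply: Mval.
Qed.

Let addA : associative residue_add.
Proof.
move=> u v w; rewrite -(val_K u) -(val_K v) -(val_K w).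
by rewrite !addE ?addrA //; apply: OD.
Qed.
Let addC : commutative residue_add.
Proof. by move=> u v; rewrite /residue_add addrC. Qed.
Let add0 : left_id (pi 0) residue_add.
Proof. by move=> u; rewrite -(val_K u) addE // add0r. Qed.
Let addN : left_inverse (pi 0) residue_opp residue_add.
Proof. by move=> u; rewrite -(val_K u) oppE // addE ?addNr //; apply: ON. Qed.
HB.instance Definition _ := GRing.isZmodule.Build residue addA addC add0 addN.

Let mulA : associative residue_mul.
Proof.
move=> u v w; rewrite -(val_K u) -(val_K v) -(val_K w).
by rewrite !mulE ?mulrA //; apply: OM.
Qed.
Let mulC : commutative residue_mul.
Proof. by move=> u v; rewrite /residue_mul mulrC. Qed.
Let mul1 : left_id (pi 1) residue_mul.
Proof. by move=> u; rewrite -(val_K u) mulE // mul1r. Qed.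
Let mulD : left_distributive residue_mul residue_add.
Proof.
move=> u v w; rewrite -(val_K u) -(val_K v) -(val_K w).
by rewrite addE // !mulE ?addE ?mulrDl //; [apply: OM | apply: OM | apply: OD].
Qed.
Let pi1_neq0 : pi 1 != pi 0.
Proof. by apply/eqP => /(residue_piP O1 O0); rewrite subr0; apply: lmax1. Qed.
HB.instance Definition _ :=
  GRing.Zmodule_isComNzRing.Build residue mulA mulC mul1 mulD pi1_neq0.

Let mulV (u : residue) : u != 0 -> residue_inv u * u = 1.
Proof.
rewrite -{1 3}(val_K u) => u0; rewrite /residue_inv.
have nMu : ~ M (val u).
  move=> Mu; move/eqP: u0; apply; apply/residue_piP => //.
  by rewrite subr0.
rewrite val_K in u0; rewrite (negPf u0).
have Oi := lring_inv (val_in u) nMu.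
change (residue_mul (pi (val u)^-1) (pi (val u)) = pi 1); rewrite mulE // mulVf //.
by apply/eqP => e; apply: nMu; rewrite e.
Qed.
Let inv0 : residue_inv 0 = 0.
Proof. by rewrite /residue_inv eqxx. Qed.
HB.instance Definition _ := GRing.ComNzRing_isField.Build residue mulV inv0.

(** The clauses are those imposed on [rho] in [DInequality], where [O] will be the localization of a
    finitely generated algebra at a prime. *)
Lemma residue_field : exists (F : fieldType) (rho : K -> F),
  [/\ forall x y, O x -> O y ->
        rho (x + y) = rho x + rho y /\ rho (x * y) = rho x * rho y,
      rho 1 = 1,
      forall z, exists x, O x /\ rho x = z &
      forall x, O x -> rho x = 0 <-> M x].
Proof.
exists residue, pi; split=> //.
- by move=> x y Ox Oy; split; [rewrite -addE | rewrite -mulE].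
- exact: residue_pi_surj.
- by move=> x Ox; rewrite -{2}(subr0 x); apply: residue_piP.
Qed.

End ResidueField.

(** * Rings, localizations and Chevalley's extension theorem *)

Lemma subs_anti (T : Type) (A B : T -> Prop) : subs A B -> subs B A -> A = B.
Proof. by move=> h1 h2; apply/funext => x; apply/propext; split; [exact: h1 | exact: h2]. Qed.

(** [Zorn_bigcup] is applied to the sets whose union with [A0] satisfies [Pr]. Taking this union
    keeps everything above [A0], and the empty chain is then covered by [Pr A0]. *)
Lemma zorn_above (T : Type) (Pr : (T -> Prop) -> Prop) (A0 : T -> Prop) :
  Pr A0 ->
  (forall F : (T -> Prop) -> Prop, (exists B, F B) ->
     (forall B, F B -> Pr B /\ subs A0 B) ->
     (forall B C, F B -> F C -> subs B C \/ subs C B) ->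
     Pr (fun x => exists2 B, F B & B x)) ->
  exists A, [/\ subs A0 A, Pr A & forall B, Pr B -> subs A B -> B = A].
Proof.
move=> PA0 chain; pose up (X : set T) : T -> Prop := fun x => X x \/ A0 x.
have upE X : subs A0 X -> up X = X.
  by move=> A0X; apply: subs_anti => x; [case=> // /A0X | left].
have [|A [PA Amax]] := @Zorn_bigcup T (fun X => Pr (up X)).
  move=> F FP Ftot; have [[X0 FX0] | noF] := pselect (exists X, F X); last first.
    suff -> : up (\bigcup_(X in F) X)%classic = A0 by [].
    by apply: subs_anti => x; [case=> // -[X FX]; case: noF; exists X | right].
  suff -> : up (\bigcup_(X in F) X)%classic =
      (fun x => exists2 B, (exists2 X, F X & B = up X) & B x).
    apply: chain.
    - by exists (up X0), X0.
    - by move=> B [X FX ->]; split; [exact: FP | move=> x; right].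
    - move=> B C [X FX ->] [Y FY ->]; case: (Ftot X Y FX FY) => XY; [left|right];
        by move=> x [/XY|]; [left | right].
  apply: subs_anti => x.
    by case=> [[X FX Xx] | A0x];
      [exists (up X); [exists X | left] | exists (up X0); [exists X0 | right]].
  by case=> B [X FX ->] [Xx | A0x]; [left; exists X | right].
exists (up A); split=> [x|//|B PB AB]; first by right.
have A0B : subs A0 B by move=> x A0x; apply: AB; right.
apply: subs_anti => // x Bx.
have [BA | nBA] := pselect (subs B (up A)); first exact: BA.
case: (Amax B); last by rewrite upE.
split; last by move=> BA; apply: nBA => y /BA; left.
by move=> y Ay; apply: AB; left.
Qed.

Section Subrings.
Variable A : fieldType.
Implicit Types (B R S I P V X Y Z : A -> Prop).

Lemma subring0 R : subring R -> R 0. Proof. by case. Qed.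
Lemma subring1 R : subring R -> R 1. Proof. by case=> _ []. Qed.
Lemma subringD R x y : subring R -> R x -> R y -> R (x + y).
Proof. by case=> _ [_ [h _]]; apply: h. Qed.
Lemma subringN R x : subring R -> R x -> R (- x).
Proof. by case=> _ [_ [_ [h _]]]; apply: h. Qed.
Lemma subringM R x y : subring R -> R x -> R y -> R (x * y).
Proof. by case=> _ [_ [_ [_ h]]]; apply: h. Qed.
Lemma subringX R x n : subring R -> R x -> R (x ^+ n).
Proof.
move=> rR Rx; elim: n => [|n IH]; first by rewrite expr0; exact: subring1.
by rewrite exprS; apply: subringM.
Qed.
Lemma subring_sum R (I : Type) (r : seq I) (Q : pred I) (F : I -> A) :
  subring R -> (forall i, Q i -> R (F i)) -> R (\sum_(i <- r | Q i) F i).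
Proof.
by move=> rR RF; apply: big_ind => // [|x y]; [exact: subring0 | exact: subringD].
Qed.

Lemma ideal_sub R I x : ideal_of R I -> I x -> R x.
Proof. by case=> h _; apply: h. Qed.
Lemma ideal0 R I : ideal_of R I -> I 0. Proof. by case=> _ []. Qed.
Lemma idealD R I x y : ideal_of R I -> I x -> I y -> I (x + y).
Proof. by case=> _ [_ [h _]]; apply: h. Qed.
Lemma idealM R I r x : ideal_of R I -> R r -> I x -> I (r * x).
Proof. by case=> _ [_ [_ h]]; apply: h. Qed.
Lemma idealN R I x : subring R -> ideal_of R I -> I x -> I (- x).
Proof.
move=> rR iI Ix; rewrite -mulN1r; apply: (idealM iI) => //.
by apply: subringN => //; apply: subring1.
Qed.

Lemma prodset_ind X Y Z : Z 0 -> (forall x y, Z x -> Z y -> Z (x + y)) ->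
  (forall x y, X x -> Y y -> Z (x * y)) -> subs (prodset X Y) Z.
Proof.
move=> Z0 ZD ZM x [ps [hps ->]]; rewrite big_seq; apply: big_ind => // p pps.
by have [] := hps p pps; apply: ZM.
Qed.
Lemma prodset0 X Y : prodset X Y 0.
Proof. by exists [::]; rewrite big_nil. Qed.
Lemma prodsetD X Y x y : prodset X Y x -> prodset X Y y -> prodset X Y (x + y).
Proof.
move=> [ps [hps ->]] [qs [hqs ->]]; exists (ps ++ qs); rewrite big_cat; split=> //.
by move=> p; rewrite mem_cat => /orP[/hps | /hqs].
Qed.
Lemma prodsetM X Y x y : X x -> Y y -> prodset X Y (x * y).
Proof.
move=> Xx Yy; exists [:: (x, y)]; rewrite big_seq1; split=> // p.
by rewrite inE => /eqP ->.
Qed.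
Lemma prodsetS X X' Y Y' : subs X X' -> subs Y Y' ->
  subs (prodset X Y) (prodset X' Y').
Proof.
move=> sX sY; apply: prodset_ind; [exact: prodset0 | exact: prodsetD |].
by move=> x y Xx Yy; apply: prodsetM; [exact: sX | exact: sY].
Qed.
Lemma prodset_ideal R P : subring R -> subs P R -> ideal_of R (prodset P R).
Proof.
move=> rR PR; split; last split; last split.
- apply: prodset_ind => [|x y|x y /PR]; first exact: subring0.
    exact: subringD.
  exact: subringM.
- exact: prodset0.
- exact: prodsetD.
- move=> r x Rr; apply: (@prodset_ind P R (fun z => prodset P R (r * z))).
  + by rewrite mulr0; apply: prodset0.
  + by move=> a b ha hb; rewrite mulrDr; apply: prodsetD.
  + by move=> a b Pa Rb; rewrite mulrCA; apply: prodsetM => //; apply: subringM.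
Qed.

Section Localization.
Variables (R P : A -> Prop).
Hypotheses (rR : subring R) (pP : prime_of R P).
Let iP : ideal_of R P. Proof. by case: pP. Qed.

Lemma prime_notin1 : ~ P 1. Proof. by case: pP => _ []. Qed.

Lemma prime_notinM a b : R a -> R b -> ~ P a -> ~ P b -> ~ P (a * b).
Proof. by move=> Ra Rb na nb; case: pP => _ [_ h] /(h a b Ra Rb) []. Qed.

Lemma prime_neq0 b : ~ P b -> b != 0.
Proof. by move=> nb; apply/eqP => b0; apply: nb; rewrite b0; exact: (ideal0 iP). Qed.

Lemma loc_incl : subs R (loc R P).
Proof.
move=> x Rx; exists x, 1; rewrite divr1; split=> //; split; first exact: subring1.
by split=> //; exact: prime_notin1.
Qed.

Lemma loc_subring : subring (loc R P).
Proof.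
split; first by apply: loc_incl; apply: subring0.
split; first by apply: loc_incl; apply: subring1.
split; last split.
- move=> x y [a [b [Ra [Rb [nb ->]]]]] [c [d [Rc [Rd [nd ->]]]]].
  exists (a * d + c * b), (b * d).
  do ![split]; [ | | exact: prime_notinM |].
  + by apply: subringD => //; apply: subringM.
  + exact: subringM.
  + by field; rewrite !prime_neq0.
- move=> x [a [b [Ra [Rb [nb ->]]]]]; exists (- a), b; rewrite mulNr.
  by split; [exact: subringN | split].
- move=> x y [a [b [Ra [Rb [nb ->]]]]] [c [d [Rc [Rd [nd ->]]]]].
  exists (a * c), (b * d).
  do ![split]; [exact: subringM|exact: subringM| exact: prime_notinM |].
  by field; rewrite !prime_neq0.
Qed.

Lemma locid_ideal : ideal_of (loc R P) (locid R P).
Proof.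
split; first by move=> x [a [b [Pa h]]]; exists a, b; split=> //; apply: (ideal_sub iP).
split.
  exists 0, 1; rewrite mul0r; do ![split] => //.
  - exact: (ideal0 iP).
  - exact: subring1.
  - exact: prime_notin1.
split.
- move=> x y [a [b [Pa [Rb [nb ->]]]]] [c [d [Pc [Rd [nd ->]]]]].
  exists (d * a + b * c), (b * d).
  do ![split]; [ | exact: subringM | exact: prime_notinM |].
  + by apply: (idealD iP); apply: (idealM iP).
  + by field; rewrite !prime_neq0.
- move=> x y [a [b [Ra [Rb [nb ->]]]]] [c [d [Pc [Rd [nd ->]]]]].
  exists (a * c), (b * d).
  do ![split]; [exact: (idealM iP)|exact: subringM| exact: prime_notinM |].
  by field; rewrite !prime_neq0.
Qed.

Lemma locid_notin1 : ~ locid R P 1.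
Proof.
case=> a [b [Pa [Rb [nb e]]]]; apply: (nb).
suff -> : b = a by [].
by rewrite -[b]mul1r e divfK // prime_neq0.
Qed.

Lemma loc_inv x : loc R P x -> ~ locid R P x -> loc R P x^-1.
Proof.
move=> [a [b [Ra [Rb [nb ->]]]]] nx; exists b, a; rewrite invf_div.
by do ![split] => // Pa; apply: nx; exists a, b.
Qed.

Lemma prodset_loc : subs (prodset P (loc R P)) (locid R P).
Proof.
apply: prodset_ind.
- exact: (ideal0 locid_ideal).
- by move=> x y; apply: (idealD locid_ideal).
- move=> x y Px [a [b [Ra [Rb [nb ->]]]]]; exists (x * a), b.
  by rewrite mulrA [x * a]mulrC; do ![split] => //; apply: (idealM iP).
Qed.

End Localization.

(* The ring B[x] (for I = B), or the extended ideal I[x] (for an ideal I). *)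
Definition adjoin I (x : A) : A -> Prop :=
  fun y => exists p : {poly A}, (forall i, I p`_i) /\ y = p.[x].

Section Adjoin.
Variables (B I : A -> Prop) (x : A).
Hypothesis iI : ideal_of B I.

Lemma adjoin0 : adjoin I x 0.
Proof. by exists 0; rewrite horner0; split=> // i; rewrite coef0; apply: (ideal0 iI). Qed.

Lemma adjoinD y z : adjoin I x y -> adjoin I x z -> adjoin I x (y + z).
Proof.
move=> [p [hp ->]] [q [hq ->]]; exists (p + q); rewrite hornerD; split=> // i.
by rewrite coefD; apply: (idealD iI).
Qed.

Lemma adjoinM y z : adjoin B x y -> adjoin I x z -> adjoin I x (y * z).
Proof.
move=> [p [hp ->]] [q [hq ->]]; exists (p * q); rewrite hornerM; split=> // i.
rewrite coefM; apply: big_ind => [||j _]; first exact: (ideal0 iI).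
  by move=> u v; apply: (idealD iI).
exact: (idealM iI).
Qed.

Lemma adjoin_incl : subs I (adjoin I x).
Proof.
move=> y Iy; exists y%:P; rewrite hornerC; split=> // i; rewrite coefC.
by case: eqP => // _; apply: (ideal0 iI).
Qed.

End Adjoin.

Lemma subring_ideal B : subring B -> ideal_of B B.
Proof.
move=> rB; split=> //; split; first exact: subring0.
by split=> y z; [exact: subringD | exact: subringM].
Qed.

Lemma adjoin_subring B x : subring B -> subring (adjoin B x).
Proof.
move=> rB; have iB := subring_ideal rB.
split; first exact: adjoin0 iB.
split; first by apply: (adjoin_incl _ iB); apply: subring1.
split; first by move=> y z; apply: (adjoinD iB).
split; last by move=> y z; apply: (adjoinM iB).
move=> y yB; rewrite -mulN1r; apply: (adjoinM iB) => //.
by apply: (adjoin_incl _ iB); apply: subringN => //; apply: subring1.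
Qed.

Lemma adjoin_gen B x : subring B -> adjoin B x x.
Proof.
move=> rB; exists 'X; rewrite hornerX; split=> // i; rewrite coefX.
by case: eqP => _; [exact: subring1 | exact: subring0].
Qed.

(** Turns the equality of [P B[x]] with [B[x]] into a polynomial relation with coefficients in
    [P B], the form that the degree argument works on. *)
Lemma prodset_adjoin B P x : subring B -> subs P B ->
  subs (prodset P (adjoin B x)) (adjoin (prodset P B) x).
Proof.
move=> rB PB; have iPB := prodset_ideal rB PB.
apply: prodset_ind; [exact: (adjoin0 _ iPB) | by move=> *; apply: (adjoinD iPB) |].
move=> y z Py zB; rewrite mulrC; apply: (adjoinM iPB) => //.
apply: (adjoin_incl _ iPB); rewrite -(mulr1 y).
by apply: prodsetM => //; apply: subring1.
Qed.

(* Clearing denominators puts a power of y in I, but y is 1 modulo I. *)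
Lemma adjoin_inv_notin1 B I y : subring B -> ideal_of B I -> ~ I 1 -> B y ->
  y != 0 -> I (1 - y) -> ~ adjoin I y^-1 1.
Proof.
move=> rB iI nI1 By y0 I1y [p [hp p1]].
have Iyn n : I (1 - y ^+ n).
  elim: n => [|n IH]; first by rewrite expr0 subrr; apply: (ideal0 iI).
  have -> : 1 - y ^+ n.+1 = (1 - y) + y * (1 - y ^+ n) by rewrite exprS; ring.
  by apply: (idealD iI) => //; apply: (idealM iI).
apply: nI1; rewrite -(subrK (y ^+ size p) 1); apply: (idealD iI) => //.
rewrite -[y ^+ _]mulr1 p1 horner_coef mulr_sumr.
apply: big_ind => [||i _]; first exact: (ideal0 iI).
  by move=> u v; apply: (idealD iI).
rewrite mulrCA mulrC; apply: (idealM iI) => //.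
have -> : y ^+ size p = y ^+ (size p - i) * y ^+ i by rewrite -exprD subnK // ltnW.
by rewrite exprVn mulfK ?expf_neq0 //; apply: subringX.
Qed.

(* Chevalley's degree argument: two relations of minimal degree reduce each
   other. *)
Lemma adjoin_both B I : subring B -> ideal_of B I -> ~ I 1 ->
  (forall y, I (1 - y) -> B y^-1) ->
  forall x, x != 0 -> adjoin I x 1 -> ~ adjoin I x^-1 1.
Proof.
move=> rB iI nI1 Binv.
suff main N x (p q : {poly A}) : x != 0 -> (forall i, I p`_i) -> (forall i, I q`_i) ->
    p.[x] = 1 -> q.[x^-1] = 1 -> (size p + size q <= N)%N -> False.
  by move=> x x0 [p [hp p1]] [q [hq q1]]; apply: (main _ x p q _ hp hq _ _ (leqnn _)).
elim: N x p q => [|N IH] x p q x0 hp hq p1 q1 sN.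
  have : size p == 0%N by lia.
  by rewrite size_poly_eq0 => /eqP pz; move/eqP: p1; rewrite pz horner0 eq_sym oner_eq0.
(* The situation is symmetric under exchanging [x] with its inverse and [p] with [q]. *)
wlog sqp : x p q x0 hp hq p1 q1 sN / (size q <= size p)%N.
  move=> W; case: (leqP (size q) (size p)) => [|/ltnW] sz.
    exact: (W x p q).
  by apply: (W x^-1 q p) => //; rewrite ?invrK ?invr_eq0 // addnC.
have p0 : p != 0.
  by apply/eqP => pz; move/eqP: p1; rewrite pz horner0 eq_sym oner_eq0.
pose n := (size p).-1.
have sp : size p = n.+1 by rewrite /n prednK // size_poly_gt0.
(* The constant term of [q] lies in [I], so its difference from 1 is a unit of [B]. *)
have I1q : I (1 - (1 - q`_0)) by have -> : 1 - (1 - q`_0) = q`_0 by ring.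
pose u := (1 - q`_0)^-1.
have Bu : B u by exact: Binv.
have q0 : 1 - q`_0 != 0.
  by apply/eqP => e; apply: nI1; move: I1q; rewrite e subr0.
(* Multiplying the relation for [q] by the n-th power of [x] and dividing by the unit expresses that
   power through lower ones. Substituting this in the leading term of [p] yields [p'], of smaller
   degree and with the same value at [x]. *)
pose p' := \poly_(i < n) (p`_i + u * q`_(n - i) * p`_n).
apply: (IH x p' q) => //.
- move=> i; rewrite coef_poly; case: ltnP => _; last exact: (ideal0 iI).
  apply: (idealD iI) => //; apply: (idealM iI) => //.
  by apply: subringM => //; apply: (ideal_sub iI).
- have qE : \sum_(i < n) q`_(n - i) * x ^+ i = x ^+ n * (1 - q`_0).
    have := q1; rewrite (@horner_coef_wide _ n.+1) -?sp // sp big_ord_recl expr0 mulr1.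
    move=> /(canRL (addKr _)) e; rewrite addrC -e.
    rewrite mulr_sumr (reindex_inj rev_ord_inj) /=; apply: eq_bigr => i _.
    rewrite subKn // /bump leq0n add1n mulrCA; congr (_ * _).
    have -> : x ^+ n = x ^+ (n - i.+1) * x ^+ i.+1 by rewrite -exprD subnK.
    by rewrite exprVn mulfK ?expf_neq0.
  rewrite horner_poly.
  under eq_bigr do rewrite mulrDl.
  rewrite big_split /=.
  have -> : \sum_(i < n) u * q`_(n - i) * p`_n * x ^+ i =
      u * p`_n * \sum_(i < n) q`_(n - i) * x ^+ i.
    by rewrite mulr_sumr; apply: eq_bigr => i _; ring.
  rewrite qE -[RHS]p1 horner_coef sp big_ord_recr /=; congr (_ + _).
  by rewrite /u; field.
- by have := size_poly n (fun i => p`_i + u * q`_(n - i) * p`_n); rewrite -/p'; lia.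
Qed.

Definition valuation_ring (V : A -> Prop) :=
  subring V /\ forall x, x != 0 -> V x \/ V x^-1.

(** Take [V] maximal among the rings [B] containing [loc R P] in which [P] generates a proper ideal.
    If [V] missed both [x] and its inverse, maximality would make 1 a polynomial in each of them
    with coefficients in [P V], which [adjoin_both] excludes. *)
Lemma valuation_extension R P : subring R -> prime_of R P ->
  exists V, [/\ valuation_ring V, subs R V,
    forall p, P p -> p != 0 -> ~ V p^-1 &
    forall s, R s -> ~ P s -> V s^-1].
Proof.
move=> rR pP; have iP : ideal_of R P by case: pP.
pose good B := [/\ subring B, subs (loc R P) B & ~ prodset P B 1].
have [||V [_ [rV LV nV1] Vmax]] := @zorn_above A good (loc R P).
- split=> //; first exact: loc_subring.
  by move=> /(prodset_loc rR pP); apply: locid_notin1.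
- move=> F [B0 FB0] Fgood Ftot.
  have U2 x y : (exists2 B, F B & B x) -> (exists2 B, F B & B y) ->
      exists2 B, F B & B x /\ B y.
    move=> [B FB Bx] [C FC Cy]; case: (Ftot B C FB FC) => h; [exists C|exists B] => //;
      by split=> //; apply: h.
  have Fr B : F B -> subring B by move=> /Fgood[[]].
  split.
  + split; first by exists B0 => //; apply: subring0; apply: Fr.
    split; first by exists B0 => //; apply: subring1; apply: Fr.
    split; last split.
    * by move=> x y Fx Fy; have [B FB []] := U2 x y Fx Fy; exists B => //;
        apply: subringD => //; apply: Fr.
    * by move=> x [B FB Bx]; exists B => //; apply: subringN => //; apply: Fr.
    * by move=> x y Fx Fy; have [B FB []] := U2 x y Fx Fy; exists B => //;
        apply: subringM => //; apply: Fr.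
  + by move=> x Lx; exists B0 => //; have [[_ h _] _] := Fgood _ FB0; apply: h.
  (* A sum expressing 1 has finitely many terms, so it already lives over a single member of the
     chain. *)
  + move=> h1.
    have [//|||B FB hB] := @prodset_ind P (fun x => exists2 B, F B & B x)
        (fun x => exists2 B, F B & prodset P B x) _ _ _ 1 h1.
    * by exists B0 => //; apply: prodset0.
    * move=> x y [B FB Bx] [C FC Cy]; case: (Ftot B C FB FC) => h;
        [exists C|exists B] => //; apply: prodsetD => //;
        by [move: Bx; apply: prodsetS | move: Cy; apply: prodsetS].
    * by move=> x y Px [B FB By]; exists B => //; apply: prodsetM.
    * by have [[_ _ h] _] := Fgood _ FB; apply: h.
have RV : subs R V by move=> x Rx; apply: LV; apply: loc_incl.
have PV : subs P V by move=> x Px; apply: RV; apply: (ideal_sub iP).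
have iPV := prodset_ideal rV PV.
have ext x : ~ V x -> adjoin (prodset P V) x 1.
  move=> nVx; apply: contrapT => n1; apply: nVx.
  rewrite -(Vmax (adjoin V x)); first exact: adjoin_gen.
  - split; first exact: adjoin_subring.
      by move=> y /LV; apply: (adjoin_incl _ (subring_ideal rV)).
    by move=> /(prodset_adjoin rV PV).
  - exact: (adjoin_incl _ (subring_ideal rV)).
exists V; split=> //.
- split=> // x x0; apply: contrapT => /not_orP[nx nxi].
  (* It remains to see that 1 + [P V] consists of units: a [y] in it without inverse in [V] would,
     by [ext], give a relation in the inverse of [y], against [adjoin_inv_notin1]. *)
  apply: (adjoin_both rV iPV nV1 _ x0 (ext _ nx) (ext _ nxi)) => y hy.
  apply: contrapT => nyi.
  have Vy : V y.
    have -> : y = 1 - (1 - y) by ring.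
    apply: subringD; [by []|exact: subring1|apply: subringN => //].
    exact: (ideal_sub iPV).
  have y0 : y != 0 by apply/eqP => e; apply: nV1; move: hy; rewrite e subr0.
  exact: (adjoin_inv_notin1 rV iPV nV1 Vy y0 hy (ext _ nyi)).
- by move=> p Pp p0 Vp; apply: nV1; rewrite -(mulfV p0); apply: prodsetM.
- move=> s Rs nPs; apply: LV; exists 1, s; rewrite mul1r.
  by split=> //; exact: subring1.
Qed.

End Subrings.

(** * Lifting chains of primes to a valuation ring *)

Section Chains.
Variable T : Type.
Implicit Types (l : seq (T -> Prop)) (a b x : T -> Prop).

Lemma Forall_rcons (U : Type) (Q : U -> Prop) (l : seq U) (a : U) :
  List.Forall Q (rcons l a) <-> List.Forall Q l /\ Q a.
Proof.
elim: l => [|b l IH] /=; first by split=> [h|[_ Qa]]; [inversion h | constructor].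
split=> [h | [h Qa]].
  by inversion h; subst; case: IH => /(_ H2) [Fl Qa] _; split=> //; constructor.
by inversion h; subst; constructor=> //; apply/IH.
Qed.

Lemma schain_rcons l a b :
  schain (rcons (a :: l) b) <-> schain (a :: l) /\ ssubs (last a l) b.
Proof.
elim: l a => [|c l IH] a /=; first by tauto.
by have := IH c; rewrite /=; tauto.
Qed.

Lemma schain_sub_last l b : schain (rcons l b) -> List.Forall (fun a => subs a b) (rcons l b).
Proof.
elim: l => [|a l IH]; first by move=> _; constructor.
rewrite rcons_cons => h.
have [hac hl] : subs a (head b l) /\ schain (rcons l b).
  by case: l h {IH} => [|c l] /= [[h1 _] h2].
have Fl := IH hl; constructor=> //.
suff hb : subs (head b l) b by move=> x /hac /hb.
by case: l Fl {h IH hac hl} => [|c l] //= h; inversion h.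
Qed.
End Chains.

Section ValuationChains.
Variable K : fieldType.
Implicit Types (V D P m q : K -> Prop).

(** The maximal ideal when [V] is a valuation ring. Zero is listed apart because [0^-1] is 0, which
    lies in [V]. *)
Definition nonunits V : K -> Prop := fun x => V x /\ (x = 0 \/ ~ V x^-1).

Lemma nonunitsP V x : V x -> ~ nonunits V x <-> x != 0 /\ V x^-1.
Proof.
move=> Vx; split.
  move=> h; split; first by apply/eqP => x0; apply: h; split=> //; left.
  by apply: contrapT => nV; apply: h; split=> //; right.
by move=> [/eqP x0 Vi] [_ []].
Qed.

Lemma nonunits_prime V : valuation_ring V -> prime_of V (nonunits V).
Proof.
move=> [rV vV].
have V0 := subring0 rV; have V1 := subring1 rV.
have MM r x : V r -> nonunits V x -> nonunits V (r * x).
  move=> Vr [Vx hx]; split; first exact: subringM.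
  have [-> | r0] := eqVneq r 0; first by rewrite mul0r; left.
  case: hx => [-> | nVi]; first by rewrite mulr0; left.
  right=> h; apply: nVi; suff -> : x^-1 = r * (r * x)^-1 by apply: subringM.
  by rewrite invfM mulrA mulfV ?mul1r.
split; last split.
- split; first by move=> x [].
  split; first by split=> //; left.
  split=> // x y hx hy.
  have [-> | x0] := eqVneq x 0; first by rewrite add0r.
  have [-> | y0] := eqVneq y 0; first by rewrite addr0.
  have xy0 : x / y != 0 by rewrite mulf_neq0 ?invr_neq0.
  (* One of the two quotients of [x] and [y] lies in [V], which makes the sum a multiple of a single
     summand. *)
  case: (vV _ xy0) => h.
    have -> : x + y = (x / y + 1) * y by field.
    by apply: MM => //; apply: subringD.
  have -> : x + y = ((x / y)^-1 + 1) * x by field; rewrite x0 y0.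
  by apply: MM => //; apply: subringD.
- by apply/(nonunitsP V1); rewrite invr1 oner_neq0.
- move=> a b Va Vb hab; apply: contrapT => /not_orP[].
  move=> /(nonunitsP Va)[a0 ia] /(nonunitsP Vb)[b0 ib].
  apply: (iffRL (nonunitsP (subringM rV Va Vb))) hab.
  by rewrite mulf_neq0 // invfM; split=> //; apply: subringM.
Qed.

Lemma prime_restrict V V' q : prime_of V q -> subs V' V -> subring V' ->
  prime_of V' (fun x => V' x /\ q x).
Proof.
move=> [iq [q1 hq]] VV' rV'; split; last split.
- split; first by move=> x [].
  split; first by split; [exact: subring0 | exact: (ideal0 iq)].
  split=> [x y [hx qx] [hy qy] | r x hr [hx qx]].
    by split; [exact: subringD | exact: (idealD iq)].
  by split; [exact: subringM | apply: (idealM iq) => //; apply: VV'].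
- by case.
- by move=> a b ha hb [_] /(hq a b (VV' a ha) (VV' b hb)) []; [left|right].
Qed.

(** Chevalley's theorem is applied to the ring D + m and its prime P + m, which contracts to P
    because m meets D in p, a subset of P. An element of [V'] outside [V] would have its inverse in
    m, hence among the nonunits of [V'], which is absurd; so [V'] lies in [V]. *)
Lemma valuation_chain_step D V P m p : subring D -> valuation_ring V -> subs D V ->
  m = nonunits V -> (forall x, D x -> m x <-> p x) ->
  prime_of D P -> subs p P ->
  exists V', [/\ valuation_ring V', subs D V', subs V' V, subs m (nonunits V') &
    forall x, D x -> nonunits V' x <-> P x].
Proof.
move=> rD vV DV mE mD pP spP; have [rV hV] := vV.
have im : ideal_of V m by rewrite mE; case: (nonunits_prime vV).
have [iP [P1 PM]] := pP.
pose R2 x := exists d e, [/\ D d, m e & x = d + e].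
pose P2 x := exists d e, [/\ P d, m e & x = d + e].
have m0 := ideal0 im.
have P2D x : D x -> P2 x -> P x.
  move=> Dx [d [e [Pd me xE]]]; rewrite xE; apply: (idealD iP) => //.
  apply: spP; apply/mD => //; have -> : e = x - d by rewrite xE; ring.
  apply: subringD => //; apply: subringN => //; exact: (ideal_sub iP).
have mMl d e : D d -> m e -> m (d * e) by move=> /DV Dd; apply: (idealM im).
have mMr d e : D d -> m e -> m (e * d) by rewrite mulrC; apply: mMl.
have mMm d e : m d -> m e -> m (d * e) by move=> /(ideal_sub im); apply: (idealM im).
have mM4 d e d' e' : D d -> D d' -> m e -> m e' -> m (d * e' + e * d' + e * e').
  by move=> *; do 2?[apply: (idealD im)]; auto.
have rR2 : subring R2.
  split; first by exists 0, 0; rewrite addr0; split=> //; exact: subring0.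
  split; first by exists 1, 0; rewrite addr0; split=> //; exact: subring1.
  split; last split.
  - move=> x y [d [e [Dd me ->]]] [d' [e' [Dd' me' ->]]]; exists (d + d'), (e + e').
    by rewrite addrACA; split=> //; [exact: subringD | exact: (idealD im)].
  - move=> x [d [e [Dd me ->]]]; exists (- d), (- e).
    by rewrite opprD; split=> //; [exact: subringN | exact: (idealN rV im)].
  - move=> x y [d [e [Dd me ->]]] [d' [e' [Dd' me' ->]]].
    exists (d * d'), (d * e' + e * d' + e * e').
    by split; [exact: subringM | exact: mM4 | ring].
have pP2 : prime_of R2 P2.
  split; last split.
  - split; first by move=> x [d [e [Pd me ->]]]; exists d, e; split=> //; exact: (ideal_sub iP).
    split; first by exists 0, 0; rewrite addr0; split=> //; exact: (ideal0 iP).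
    split.
      move=> x y [d [e [Dd me ->]]] [d' [e' [Dd' me' ->]]]; exists (d + d'), (e + e').
      by rewrite addrACA; split=> //; [exact: (idealD iP) | exact: (idealD im)].
    move=> x y [d [e [Dd me ->]]] [d' [e' [Dd' me' ->]]].
    exists (d * d'), (d * e' + e * d' + e * e').
    by split; [exact: (idealM iP) | apply: mM4 => //; exact: (ideal_sub iP) | ring].
  - by move/(P2D 1 (subring1 rD)).
  - move=> x y [d [e [Dd me ->]]] [d' [e' [Dd' me' ->]]] [f [g [Pf mg e1]]].
    (* Removing the terms that lie in [m] leaves [d * d'] in the contraction of P + m to D, which is
       P. *)
    have : P (d * d').
      apply: P2D; first exact: subringM.
      exists f, (g - (d * e' + e * d' + e * e')); split=> //.
        by apply: (idealD im) => //; apply: (idealN rV im); exact: mM4.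
      by rewrite addrA -e1; ring.
    by move=> /(PM d d' Dd Dd')[h|h]; [left; exists d, e | right; exists d', e'].
have [V' [vV' RV' PV' sV']] := valuation_extension rR2 pP2.
have DV' : subs D V'.
  by move=> x Dx; apply: RV'; exists x, 0; rewrite addr0.
have mP2 x : m x -> P2 x.
  by move=> mx; exists 0, x; rewrite add0r; split=> //; exact: (ideal0 iP).
have PP2 x : P x -> P2 x by move=> Px; exists x, 0; rewrite addr0.
have P2n x : P2 x -> nonunits V' x.
  move=> P2x; split; first by apply: RV'; case: pP2 => i2 _; exact: (ideal_sub i2).
  by have [-> | x0] := eqVneq x 0; [left | right; exact: PV'].
exists V'; split=> //.
- move=> x V'x; have [-> | x0] := eqVneq x 0; first exact: subring0.
  apply: contrapT => nVx; have [//|Vi] := hV x x0.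
  suff mi : m x^-1 by apply: (PV' x^-1 (mP2 _ mi)); rewrite ?invr_eq0 // invrK.
  by rewrite mE; split=> //; right; rewrite invrK.
- by move=> x /mP2 /P2n.
- move=> x Dx; split; last by move=> /PP2 /P2n.
  move=> nx; apply: contrapT => nPx.
  have Ri : V' x^-1.
    apply: sV' => [|/(P2D x Dx)//]; exists x, 0; rewrite addr0; split=> //.
  case: nx => _ [x0 | //]; apply: nPx; rewrite x0; exact: (ideal0 iP).
Qed.

(** Induction adding primes at the top, from the valuation ring [K] whose only nonunit is 0. With
    [nonunits V] the chain has one more member than [l], which accounts for the zero prime. *)
Lemma valuation_chain D (l : seq (K -> Prop)) : subring D ->
  List.Forall (prime_of D) l -> schain (@zeroset K :: l) ->
  exists V ls, [/\ valuation_ring V, subs D V, size ls = size l,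
    List.Forall (prime_of V) (rcons ls (nonunits V)) /\ schain (rcons ls (nonunits V)) &
    forall x, D x -> nonunits V x <-> last (@zeroset K) l x].
Proof.
move=> rD; elim/last_ind: l => [_ _ | l P IH].
  have vT : valuation_ring (fun _ : K => True) by do !split; left.
  exists (fun _ => True), [::]; split=> //.
  - by split=> //; apply: List.Forall_cons => //; exact: nonunits_prime.
  - by move=> x Dx; split=> [[_ []] // | ->]; split=> //; left.
move=> /Forall_rcons[Fl pP]; rewrite -rcons_cons => /schain_rcons[Cl [slP [x0 [Px0 nx0]]]].
have [V [ls [vV DV sls [Fls Cls] mD]]] := IH Fl Cl.
have iP : ideal_of D P by case: pP.
have [V' [vV' DV' V'V mm' m'D]] :=
  valuation_chain_step rD vV DV erefl mD pP slP.
exists V', (rcons ls (nonunits V)); rewrite last_rcons !size_rcons sls; split=> //.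
split.
  apply/Forall_rcons; split; last exact: nonunits_prime.
  (* The earlier primes lie in the nonunits of [V], hence inside [V'], so contraction to [V'] leaves
     them unchanged and they stay prime. *)
  have Fs := schain_sub_last Cls.
  have : List.Forall (fun q => prime_of V q /\ subs q (nonunits V)) (rcons ls (nonunits V)).
    by apply/List.Forall_and.
  apply: List.Forall_impl => q [pq sq].
  suff <- : (fun x => V' x /\ q x) = q by apply: (prime_restrict pq) => //; case: vV'.
  apply: subs_anti => x; first by case.
  by move=> qx; split=> //; case: (mm' x (sq x qx)).
(* Strictness is visible in [D], through an element of [P] outside the preceding prime. *)
have E : ssubs (nonunits V) (nonunits V').
  split=> //; exists x0; have Dx0 := ideal_sub iP Px0.
  by split; [apply/m'D | move/(mD x0 Dx0)].
case: ls Cls {sls Fls} => [|a ls] Cls; first by split.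
apply/schain_rcons; split; first exact: Cls.
by rewrite last_rcons.
Qed.

End ValuationChains.

(** * Quasi-ideals for semistar operations of finite type *)

Section FiniteType.
Variables (K : fieldType) (D : K -> Prop).
Hypothesis rD : subring D.
Implicit Types (E F I J M P : K -> Prop) (xs ys : seq K).

Lemma fgen_sub xs E : E 0 -> (forall x y, E x -> E y -> E (x + y)) ->
  (forall d x, D d -> E x -> E (d * x)) -> (forall x, x \in xs -> E x) ->
  subs (fgen D xs) E.
Proof.
move=> E0 ED EM Exs x [ds [sds [Dds ->]]].
apply: big_ind => // i _; apply: EM; last by apply: Exs; apply: mem_nth.
by apply: Dds; apply: mem_nth; rewrite sds.
Qed.

Lemma fgen_closed xs :
  [/\ fgen D xs 0, forall x y, fgen D xs x -> fgen D xs y -> fgen D xs (x + y) &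
      forall d x, D d -> fgen D xs x -> fgen D xs (d * x)].
Proof.
pose n := size xs.
have mk (f : nat -> K) : (forall i, (i < n)%N -> D (f i)) -> fgen D xs (\sum_(i < n) f i * xs`_i).
  move=> Df; exists (mkseq f n); rewrite size_mkseq; split=> //; split.
    by move=> d /mapP[i]; rewrite mem_iota add0n => /andP[_ lin] ->; apply: Df.
  by apply: eq_bigr => i _; rewrite nth_mkseq.
have nD ds i : size ds = n -> (forall d, d \in ds -> D d) -> (i < n)%N -> D ds`_i.
  by move=> sds Dds lin; apply: Dds; apply: mem_nth; rewrite sds.
split.
- have -> : 0 = \sum_(i < n) 0 * xs`_i.
    by rewrite big1 // => i _; rewrite mul0r.
  by apply: (mk (fun=> 0)) => i _; exact: subring0.
- move=> x y [ds [sds [Dds ->]]] [es [ses [Des ->]]].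
  rewrite -big_split /=; under eq_bigr do rewrite -mulrDl.
  apply: (mk (fun i => ds`_i + es`_i)) => i lin.
  by apply: subringD => //; apply: nD.
- move=> d x Dd [ds [sds [Dds ->]]]; rewrite mulr_sumr.
  under eq_bigr do rewrite mulrA.
  by apply: (mk (fun i => d * ds`_i)) => i lin; apply: subringM => //; apply: nD.
Qed.

Lemma fgen_mem xs x : x \in xs -> fgen D xs x.
Proof.
move=> xin; pose k := index x xs.
exists (mkseq (fun i => (i == k)%:R) (size xs)); rewrite size_mkseq; split=> //; split.
  move=> d /mapP[i _ ->]; case: eqP => _; [exact: subring1 | exact: subring0].
have kl : (k < size xs)%N by rewrite index_mem.
rewrite (bigD1 (Ordinal kl)) //= nth_mkseq // eqxx mul1r nth_index // big1 ?addr0 //.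
by move=> i ik; rewrite nth_mkseq // -val_eqE /= in ik *; rewrite (negPf ik) mul0r.
Qed.

Lemma fgen_submod xs : (exists x, x \in xs /\ x != 0) -> submod D (fgen D xs).
Proof.
move=> [x [xin x0]]; have [h1 h2 h3] := fgen_closed xs.
by do !split => //; exists x; split=> //; apply: fgen_mem.
Qed.

Lemma fin_fracE F : fin_frac D F -> exists2 xs, (exists x, x \in xs /\ x != 0) & F = fgen D xs.
Proof. by move=> [xs [nz e]]; exists xs => //; apply: subs_anti => x /e. Qed.

Lemma fgen_fin_frac xs : (exists x, x \in xs /\ x != 0) -> fin_frac D (fgen D xs).
Proof. by move=> nz; exists xs; split. Qed.

Lemma fin_frac_submod F : fin_frac D F -> submod D F.
Proof. by move=> /fin_fracE[xs nz ->]; apply: fgen_submod. Qed.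

(** Directedness of the union defining [star_f]: the sum of [F] and [G] is the common bound. *)
Lemma fin_frac_join F G E : submod D E -> fin_frac D F -> fin_frac D G ->
  subs F E -> subs G E -> exists H, [/\ fin_frac D H, subs H E, subs F H & subs G H].
Proof.
move=> [E0 [ED [EM _]]] /fin_fracE[xs nzx ->] /fin_fracE[ys nzy ->] sx sy.
have [h1 h2 h3] := fgen_closed (xs ++ ys).
exists (fgen D (xs ++ ys)); split.
- apply: fgen_fin_frac; case: nzx => x [xin x0].
  by exists x; rewrite mem_cat xin.
- apply: fgen_sub => // x; rewrite mem_cat => /orP[] xin;
    by [apply: sx; apply: fgen_mem | apply: sy; apply: fgen_mem].
- by apply: fgen_sub => // x xin; apply: fgen_mem; rewrite mem_cat xin.
- by apply: fgen_sub => // x xin; apply: fgen_mem; rewrite mem_cat xin orbT.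
Qed.

Lemma ideal_submod I : ideal_of D I -> (exists x, I x /\ x != 0) -> submod D I.
Proof. by move=> [h1 [h2 [h3 h4]]] nz; do !split. Qed.

Lemma fgen1_fin_frac x : x != 0 -> fin_frac D (fgen D [:: x]).
Proof. by move=> x0; apply: fgen_fin_frac; exists x; rewrite inE. Qed.

Variable star : (K -> Prop) -> (K -> Prop).
Hypothesis sstar : semistar D star.

Lemma star_submod E : submod D E -> submod D (star E).
Proof. by case: sstar => h _; apply: h. Qed.
Lemma star_mono E F : submod D E -> submod D F -> subs E F -> subs (star E) (star F).
Proof. by case: sstar => _ [_ [h _]]; apply: h. Qed.
Lemma star_incl E : submod D E -> subs E (star E).
Proof. by case: sstar => _ [_ [_ [h _]]]; apply: h. Qed.
Lemma star_idem E : submod D E -> subs (star (star E)) (star E).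
Proof. by case: sstar => _ [_ [_ [_ h]]] sE x /(h E sE). Qed.
Lemma star_scale b E x : b != 0 -> submod D E -> star E x -> star (scale b E) (b * x).
Proof. by case: sstar => _ [h _] b0 sE Ex; apply/(h b E b0 sE); exists x. Qed.

Lemma star_f_incl E x : submod D E -> E x -> star_f D star E x.
Proof.
move=> sE Ex; have [E0 [ED [EM [y [Ey y0]]]]] := sE.
(* The element [x] may be 0, whereas [fin_frac] asks for a nonzero generator; [y] provides it. *)
have nz : exists z, z \in [:: x; y] /\ z != 0 by exists y; rewrite !inE eqxx orbT.
exists (fgen D [:: x; y]); split; first exact: fgen_fin_frac; split.
  by apply: fgen_sub => // z; rewrite !inE => /orP[] /eqP ->.
apply: star_incl; first exact: fgen_submod.
by apply: fgen_mem; rewrite inE eqxx.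
Qed.

Lemma star_f_seq E xs : submod D E -> (forall x, x \in xs -> star_f D star E x) ->
  exists F, [/\ fin_frac D F, subs F E & forall x, x \in xs -> star F x].
Proof.
move=> sE; elim: xs => [_ | a xs IH h].
  have [E0 [ED [EM [y [Ey y0]]]]] := sE.
  exists (fgen D [:: y]); split=> //; first exact: fgen1_fin_frac.
  by apply: fgen_sub => // z; rewrite !inE => /eqP ->.
have [|F [fF FE hF]] := IH; first by move=> x xin; apply: h; rewrite inE xin orbT.
have [|G [fG [GE hG]]] := h a; first by rewrite inE eqxx.
have [H [fH HE FH GH]] := fin_frac_join sE fF fG FE GE.
exists H; split=> // x; rewrite inE => /orP[/eqP -> | /hF].
  by move: hG; apply: star_mono => //; apply: fin_frac_submod.
by apply: star_mono => //; apply: fin_frac_submod.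
Qed.

(** By directedness the finitely many generators of [G] lie in [star F] for one [F] inside [E], and
    idempotence of [star] applies to this [F]. *)
Lemma star_f_idem E G x : submod D E -> fin_frac D G -> subs G (star_f D star E) ->
  star G x -> star_f D star E x.
Proof.
move=> sE /fin_fracE[xs nz ->] sG Gx.
have [|F [fF FE hF]] := @star_f_seq E xs sE.
  by move=> y yin; apply: sG; apply: fgen_mem.
have sF := fin_frac_submod fF; have ssF := star_submod sF.
exists F; do !split=> //; apply: star_idem => //.
move: Gx; apply: star_mono => //; first exact: fgen_submod.
by case: ssF => F0 [FD [FM _]]; apply: fgen_sub.
Qed.

Lemma star_f_submod E : submod D E -> submod D (star_f D star E).
Proof.
move=> sE; have [E0 [ED [EM [y [Ey y0]]]]] := sE.
split; first exact: star_f_incl.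
split; last split; last by exists y; split=> //; apply: star_f_incl.
- move=> x z hx hz; have [|F [fF FE hF]] := @star_f_seq E [:: x; z] sE.
    by move=> u; rewrite !inE => /orP[] /eqP ->.
  exists F; do !split=> //; have [_ [h _]] := star_submod (fin_frac_submod fF).
  by apply: h; apply: hF; rewrite !inE eqxx ?orbT.
- move=> d x Dd [F [fF [FE Fx]]].
  exists F; do !split=> //; have [_ [_ [h _]]] := star_submod (fin_frac_submod fF).
  exact: h.
Qed.

Lemma qideal_star_f I : ideal_of D I -> (exists x, I x /\ x != 0) ->
  qideal D (star_f D star) (fun x => star_f D star I x /\ D x).
Proof.
move=> iI nzI; have sI := ideal_submod iI nzI.
have [S0 [SD [SM _]]] := star_f_submod sI.
split; last split.
- split; first by move=> x [].
  split; first by split=> //; exact: subring0.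
  split=> [x y [hx Dx] [hy Dy] | r x Dr [hx Dx]].
    by split; [exact: SD | exact: subringD].
  by split; [exact: SM | exact: subringM].
- case: nzI => x [Ix x0]; exists x; split=> //; split; first exact: star_f_incl.
  exact: (ideal_sub iI).
- move=> x; split=> [[[F [fF [FJ Fx]]] Dx] | [hx Dx]].
    by split=> //; apply: (star_f_idem sI fF) => // y /FJ[].
  split=> //; apply: star_f_incl; last by split.
  apply: ideal_submod.
    split; first by move=> y [].
    split; first by split=> //; exact: subring0.
    split=> [y z [hy Dy] [hz Dz] | r y Dr [hy Dy]].
      by split; [exact: SD | exact: subringD].
    by split; [exact: SM | exact: subringM].
  case: nzI => y [Iy y0]; exists y; split=> //; split; first exact: star_f_incl.
  exact: (ideal_sub iI).
Qed.

(** Zorn's lemma starts at the quasi-ideal cut out on [D] by the closure of [I]. Unions of chains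
    remain quasi-ideals because [star_f] is of finite type. *)
Lemma qmax_above I : ideal_of D I -> (exists x, I x /\ x != 0) ->
  ~ star_f D star I 1 -> exists2 M, qmax D (star_f D star) M & subs I M.
Proof.
move=> iI nzI n1; have sI := ideal_submod iI nzI.
pose J x := star_f D star I x /\ D x.
have qJ : qideal D (star_f D star) J by exact: qideal_star_f.
have IJ : subs I J.
  by move=> x Ix; split; [exact: star_f_incl | exact: (ideal_sub iI)].
have [||M [JM [qM M1] Mmax]] :=
  @zorn_above K (fun B => qideal D (star_f D star) B /\ ~ B 1) J.
- by split=> // -[].
- move=> F [B0 FB0] Fgood Ftot.
  have FI B : F B -> ideal_of D B by move=> /Fgood[[[]]].
  have U2 x y : (exists2 B, F B & B x) -> (exists2 B, F B & B y) ->
      exists2 B, F B & B x /\ B y.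
    move=> [B FB Bx] [C FC Cy]; case: (Ftot B C FB FC) => h; [exists C|exists B] => //;
      by split=> //; apply: h.
  have iU : ideal_of D (fun x => exists2 B, F B & B x).
    split; first by move=> x [B /FI iB]; apply: (ideal_sub iB).
    split; first by exists B0 => //; apply: (ideal0 (FI _ FB0)).
    split=> [x y Ux Uy | r x Dr [B FB Bx]].
      by have [B FB []] := U2 x y Ux Uy; exists B => //; apply: (idealD (FI _ FB)).
    by exists B => //; apply: (idealM (FI _ FB)).
  have nzU : exists x, (exists2 B, F B & B x) /\ x != 0.
    by have [[[_ [[x [Bx x0]] _]] _] _] := Fgood _ FB0; exists x; split=> //; exists B0.
  split; last by move=> [B /Fgood[[_ h] _]].
  split=> //; split=> // x; split; last first.
    move=> Ux; split; last exact: (ideal_sub iU).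
    by apply: star_f_incl => //; apply: ideal_submod.
  move=> [[G [/fin_fracE[xs nz ->] [GU Gx]]] Dx].
  (* The finitely many generators of the witness all lie in one member of the chain. *)
  have [B FB GB] : exists2 B, F B & forall y, y \in xs -> B y.
    have : forall y, y \in xs -> exists2 B, F B & B y.
      by move=> y yin; apply: GU; apply: fgen_mem.
    elim: (xs) => [_ | a l IH h]; first by exists B0.
    have [|B FB hB] := IH; first by move=> y yin; apply: h; rewrite inE yin orbT.
    have [|C FC Ca] := h a; first by rewrite inE eqxx.
    case: (Ftot B C FB FC) => BC; [exists C | exists B] => // y;
      rewrite inE => /orP[/eqP -> | /hB] //; [exact: BC | exact: BC].
  exists B => //; have [[[iB [_ e]] _] _] := Fgood _ FB.
  apply/e; split=> //; exists (fgen D xs); split; first exact: fgen_fin_frac; split=> //.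
  by case: iB => _ [b0 [bD bM]]; apply: fgen_sub.
exists M; last by move=> x /IJ /JM.
split=> //; split=> // B qB nB1 MB x Bx.
by rewrite -(Mmax B).
Qed.

(** If [a] is outside [M], maximality forces 1 into the closure of the ideal [M + D a]. When [a * b]
    is in [M], multiplication by [b] carries this ideal into [M], and 1 to [b]. *)
Lemma qmax_prime M : qmax D (star_f D star) M -> prime_of D M.
Proof.
move=> [[iM [nzM eM]] [M1 Mmax]]; split=> //; split=> // a b Da Db Mab.
apply: contrapT => /not_orP[nMa nMb].
pose I x := exists m d, [/\ M m, D d & x = m + d * a].
have MI : subs M I.
  by move=> m Mm; exists m, 0; rewrite mul0r addr0; split=> //; exact: subring0.
have iI : ideal_of D I.
  split.
    move=> x [m [d [Mm Dd ->]]]; apply: subringD => //; first exact: (ideal_sub iM).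
    exact: subringM.
  split; first by apply: MI; exact: (ideal0 iM).
  split=> [x y [m [d [Mm Dd ->]]] [m' [d' [Mm' Dd' ->]]] | r x Dr [m [d [Mm Dd ->]]]].
    exists (m + m'), (d + d'); split; [exact: (idealD iM) | exact: subringD | ring].
  exists (r * m), (r * d); split; [exact: (idealM iM) | exact: subringM | ring].
have nzI : exists x, I x /\ x != 0 by case: nzM => x [/MI Ix x0]; exists x.
have sI := ideal_submod iI nzI.
have Ia : I a.
  exists 0, 1; rewrite mul1r add0r; split=> //; [exact: (ideal0 iM) | exact: subring1].
(* Were 1 outside this closure, the quasi-ideal it cuts out would be proper and contain both [M] and
   [a]. *)
have [[F [fF [FI F1]]] | n1] := pselect (star_f D star I 1); last first.
  apply: nMa; apply: (Mmax _ (qideal_star_f iI nzI)); first by case.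
    move=> x /MI Ix; split; [exact: star_f_incl | exact: (ideal_sub iI)].
  by split=> //; exact: star_f_incl.
have b0 : b != 0 by apply/eqP => e; apply: nMb; rewrite e; exact: (ideal0 iM).
apply: nMb; apply/eM; split=> //.
(* The witness for [b] is the module [b F], generated by the multiples of the generators of [F]. *)
have [xs [x [xin x0]] FE] := fin_fracE fF.
have nz : exists x, x \in [seq b * y | y <- xs] /\ x != 0.
  by exists (b * x); rewrite map_f // mulf_neq0.
have [f0 fD fM] := fgen_closed [seq b * y | y <- xs].
exists (fgen D [seq b * y | y <- xs]); split; first exact: fgen_fin_frac; split.
  have [_ [m0 [mD mM]]] := iM.
  apply: fgen_sub => // _ /mapP[y yin ->].
  have [m [d [Mm Dd ->]]] : I y by apply: FI; rewrite FE; apply: fgen_mem.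
  have -> : b * (m + d * a) = b * m + d * (a * b) by ring.
  by apply: mD; apply: mM.
have := star_scale b0 (fin_frac_submod fF) F1; rewrite mulr1.
have sb : subs (scale b F) (fgen D [seq b * y | y <- xs]).
  move=> _ [y [Fy ->]]; move: y Fy; rewrite FE; apply: fgen_sub => //.
  - by rewrite mulr0.
  - by move=> y z; rewrite mulrDr; apply: fD.
  - by move=> d y Dd; rewrite mulrCA; apply: fM.
  - by move=> y yin; apply: fgen_mem; apply: map_f.
apply: star_mono => //; last exact: fgen_submod.
have [F0 [FD [FM [y [Fy y0]]]]] := fin_frac_submod fF.
split; first by exists 0; rewrite mulr0.
split.
  move=> _ _ [u [Fu ->]] [v [Fv ->]]; exists (u + v).
  by rewrite mulrDr; split=> //; exact: FD.
split.
  move=> d _ Dd [u [Fu ->]]; exists (d * u).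
  by rewrite mulrCA; split=> //; exact: FM.
by exists (b * y); rewrite mulf_neq0 //; split=> //; exists y.
Qed.

Lemma stilde_mono E F : subs E F -> subs (stilde D star E) (stilde D star F).
Proof. by move=> EF x h M qM; move: (h M qM); apply: prodsetS. Qed.

Lemma stilde_incl E : subs E (stilde D star E).
Proof.
move=> x Ex M /qmax_prime pM; rewrite -(mulr1 x); apply: prodsetM => //.
by apply: loc_incl => //; exact: subring1.
Qed.

(** If [P] were contained in no quasi-maximal [M], every [P D_M] would contain 1, hence so would
    [P]. This also covers the case where there is no quasi-maximal ideal. *)
Lemma qprime_stilde_sub_qmax P : qprime D (stilde D star) P ->
  exists2 M, qmax D (star_f D star) M & subs P M.
Proof.
move=> [[iP [_ e]] [_ [P1 _]]]; apply: contrapT => noM.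
apply: P1; apply/e; split; last exact: subring1.
move=> M qM; have [x Px nMx] : exists2 x, P x & ~ M x.
  apply: contrapT => h; apply: noM; exists M => // x Px.
  by apply: contrapT => nMx; apply: h; exists x.
have Dx := ideal_sub iP Px.
rewrite -(mulfV (prime_neq0 (qmax_prime qM) nMx)); apply: prodsetM => //.
by exists 1, x; rewrite mul1r; do ![split] => //; exact: subring1.
Qed.

(* Some finitely generated F in P escapes every quasi-maximal ideal as soon as
   P does, which moves the question to the defining property of V. *)
Lemma stilde_val_center V P : star_val_overring D (stilde D star) V ->
  ideal_of D P -> (exists x, P x /\ x != 0) -> ~ prodset P V 1 ->
  ~ stilde D star P 1.
Proof.
move=> [vV hV] iP nzP n1 tP1; have sP := ideal_submod iP nzP.
(* In the first case no quasi-maximal ideal contains [F], so 1 lies in [stilde D star F] and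
   therefore in [F V]. *)
have [[F [fF [FP F1]]] | nP1] := pselect (star_f D star P 1).
  apply: n1; suff : prodset F V 1 by apply: prodsetS.
  apply: hV => // M qM; have pM := qmax_prime qM.
  have [[iM [_ e]] [M1 _]] := qM.
  have [x Fx nMx] : exists2 x, F x & ~ M x.
    apply: contrapT => h; apply: M1; apply/e; split; last exact: subring1.
    exists F; do !split=> //; move=> x Fx.
    by apply: contrapT => nMx; apply: h; exists x.
  have Dx := ideal_sub iP (FP _ Fx).
  rewrite -(mulfV (prime_neq0 pM nMx)); apply: prodsetM => //.
  by exists 1, x; rewrite mul1r; do ![split] => //; exact: subring1.
(* In the second case [P] lies in some quasi-maximal [M], and 1 in [P D_M] would lie in [M D_M]. *)
have [M qM PM] := qmax_above iP nzP nP1.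
have pM := qmax_prime qM.
apply: (locid_notin1 pM); apply: (prodset_loc rD pM).
by move: (tP1 M qM); apply: prodsetS.
Qed.

End FiniteType.

(** * Algebras generated by finitely many elements *)

Section GeneratedAlgebra.
Variables (K : fieldType) (D : K -> Prop) (g : seq K).
Hypothesis rD : subring D.

(* Written as the instance [iota := idfun] of the algebra T in [DInequality]. *)
Definition generated_algebra : K -> Prop := fun x =>
  exists ts : seq (K * seq nat),
    (forall t, t \in ts -> exists d, D d /\ t.1 = d) /\ x = peval g ts.
Notation T := generated_algebra.

Lemma mono_nil : mono g [::] = 1.
Proof. by rewrite /mono big1 // => i _; rewrite nth_nil expr0. Qed.

Lemma monoM e e' : mono g e * mono g e' =
  mono g (mkseq (fun i => nth 0%N e i + nth 0%N e' i)%N (size g)).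
Proof.
rewrite /mono -big_split /=; apply: eq_bigr => i _.
by rewrite nth_mkseq // exprD.
Qed.

Lemma generated_algebra_term d e : D d -> T (d * mono g e).
Proof.
move=> Dd; exists [:: (d, e)]; rewrite /peval big_seq1; split=> // t.
by rewrite inE => /eqP ->; exists d.
Qed.

Lemma generated_algebra_incl : subs D T.
Proof. by move=> d Dd; rewrite -(mulr1 d) -mono_nil; apply: generated_algebra_term. Qed.

Lemma generated_algebraD x y : T x -> T y -> T (x + y).
Proof.
move=> [ts [hts ->]] [us [hus ->]]; exists (ts ++ us); rewrite /peval big_cat; split=> //.
by move=> t; rewrite mem_cat => /orP[/hts | /hus].
Qed.

Lemma generated_algebraM x y : T x -> T y -> T (x * y).
Proof.
move=> [ts [hts ->]] [us [hus ->]]; rewrite /peval mulr_suml big_seq.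
have T0 : T 0 by apply: generated_algebra_incl; apply: subring0.
apply: big_ind => // [|t /hts[d [Dd ->]]]; first exact: generated_algebraD.
rewrite mulr_sumr big_seq; apply: big_ind => // [|u /hus[d' [Dd' ->]]].
  exact: generated_algebraD.
by rewrite mulrACA monoM; apply: generated_algebra_term; apply: subringM.
Qed.

Lemma generated_algebra_subring : subring T.
Proof.
have D1 := subring1 rD.
split; first by apply: generated_algebra_incl; apply: subring0.
split; first exact: generated_algebra_incl.
split; first exact: generated_algebraD.
split; last exact: generated_algebraM.
move=> x Tx; rewrite -mulN1r; apply: generated_algebraM => //.
by apply: generated_algebra_incl; apply: subringN.
Qed.

Lemma generated_algebra_gen x : x \in g -> T x.
Proof.
move=> xg; have kg : (index x g < size g)%N by rewrite index_mem.
pose e := mkseq (fun i => (i == index x g) : nat) (size g).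
suff -> : x = 1 * mono g e by apply: generated_algebra_term; exact: subring1.
rewrite mul1r /mono (bigD1 (Ordinal kg)) //= nth_mkseq // eqxx expr1 nth_index //.
rewrite big1 ?mulr1 // => i ik.
by rewrite nth_mkseq // -val_eqE /= in ik *; rewrite (negPf ik) expr0.
Qed.

Lemma generated_algebra_sub V : subring V -> subs D V -> (forall x, x \in g -> V x) ->
  subs T V.
Proof.
move=> rV DV gV x [ts [hts ->]]; rewrite /peval big_seq; apply: subring_sum => // t.
move=> /hts[d [Dd ->]]; apply: subringM => //; first exact: DV.
rewrite /mono; apply: big_ind => [|y z|i _]; first exact: subring1.
  exact: subringM.
by apply: subringX => //; apply: gV; apply: mem_nth.
Qed.

End GeneratedAlgebra.

(** One element is recorded for each strict inclusion. Contraction to any [T] containing these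
    elements then preserves strictness, so a finitely generated algebra suffices. *)
Lemma schain_witnesses (K : eqType) (V : K -> Prop) (l : seq (K -> Prop)) :
  List.Forall (fun q => subs q V) l -> schain l ->
  exists g : seq K, (forall x, x \in g -> V x) /\
    forall T : K -> Prop, (forall x, x \in g -> T x) ->
      schain [seq (fun x => T x /\ q x) | q <- l].
Proof.
elim: l => [_ _ | a [|b l] IH Fl]; [by exists [::] | by exists [::] |].
move=> [[sab [x [bx nax]]] Cl].
have [Fl' Vb] : List.Forall (fun q => subs q V) (b :: l) /\ subs b V.
  by inversion Fl; subst; split=> //; inversion H2.
have [g [gV hg]] := IH Fl' Cl; exists (x :: g); split.
  by move=> y; rewrite inE => /orP[/eqP -> | /gV //]; apply: Vb.
move=> T hT; split; last by apply: hg => y yg; apply: hT; rewrite inE yg orbT.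
split; first by move=> y [Ty /sab].
by exists x; split=> [|[_] //]; split=> //; apply: hT; rewrite inE eqxx.
Qed.

Lemma Forall_seq_map (U W : Type) (f : U -> W) (Q : W -> Prop) (l : seq U) :
  List.Forall (fun a => Q (f a)) l -> List.Forall Q [seq f a | a <- l].
Proof. by elim: l => [|a l IH] h /=; constructor; inversion h; auto. Qed.

(** The empty exponent vector is the only one available, so distinctness leaves at most one term,
    whose value is its coefficient. *)
Lemma alg_indep_nil (K : fieldType) (k : K -> Prop) : alg_indep k [::].
Proof.
move=> [|t [|t' ts]] hts Uts e u uin //.
  move: uin; rewrite inE => /eqP ->; move: e.
  by rewrite /peval big_seq1 /mono big_ord0 mulr1.
have [_ /size0nil e1] := hts t (mem_head _ _).
have [|_ /size0nil e2] := hts t'; first by rewrite !inE eqxx orbT.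
by move: Uts; rewrite /= e1 e2 inE eqxx.
Qed.

(** Over the whole field the first member [x] of a nonempty family is a root of the linear
    polynomial X - x. *)
Lemma alg_indep_full (K : fieldType) (k : K -> Prop) (xs : seq K) :
  (forall x, k x) -> alg_indep k xs -> size xs = 0%N.
Proof.
move=> kT; case: xs => // x xs ind.
pose o := nseq (size xs) 0%N.
have mE a : mono (x :: xs) (a :: o) = x ^+ a.
  rewrite /mono big_ord_recl /= big1 ?mulr1 // => i _.
  by rewrite /= nth_nseq; case: ifP; rewrite expr0.
have := ind [:: (1, 1%N :: o); (- x, 0%N :: o)] _ _ _ (1, 1%N :: o) (mem_head _ _).
move=> H; suff : (1 : K) = 0 by move/eqP; rewrite oner_eq0.
apply: H => //.
- by move=> t; rewrite !inE => /orP[] /eqP -> /=; rewrite size_nseq.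
- by rewrite /peval big_cons big_seq1 !mE /= expr1 expr0 mul1r mulr1 subrr.
Qed.

Lemma schain_last2 (T : Type) (l : seq (T -> Prop)) (a b : T -> Prop) :
  schain (rcons (rcons l a) b) -> ssubs a b.
Proof.
case: l => [[]//|c l]; rewrite rcons_cons => /schain_rcons[_].
by rewrite last_rcons.
Qed.

(** * Dimension and valuative dimension *)

Section Dimension.
Variables (K : fieldType) (D : K -> Prop) (star : (K -> Prop) -> (K -> Prop)).
Hypotheses (hD : domain_with_qf D) (sstar : semistar D star).
Let rD : subring D. Proof. by case: hD. Qed.

Lemma star_dimv_le n m : DInequality D star -> isUB (star_dim_chain D (stilde D star)) n ->
  star_dimv_chain D (stilde D star) m -> (m <= n)%N.
Proof.
move=> ineq UBn [V [starV [l [sl [Fl Cl]]]]].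
have [[rV [DV valV]] _] := starV.
case/lastP: l sl Fl Cl => // l p; rewrite size_rcons => -[sl] Fl Cl.
(* For dimension 0 the bound is trivial. Otherwise the top prime [p] strictly contains another
   prime, hence is nonzero. *)
case: m sl => // m sl.
have [Fl' pp] : List.Forall (prime_of V) l /\ prime_of V p by apply/Forall_rcons.
have ip : ideal_of V p by case: pp.
have [v pv v0] : exists2 v, p v & v != 0.
  move: sl Fl' Cl {Fl}; case/lastP: l => // l q _ /Forall_rcons[_ [iq _]] /schain_last2.
  case=> _ [v [pv nqv]]; exists v => //; apply/eqP => e; apply: nqv; rewrite e.
  exact: (ideal0 iq).
have [a [b [Da [Db [b0 vE]]]]] := hD.2 v.
have pa : p a.
  (* Clearing the denominator of [v] gives a nonzero element of [p] in [D], so the contractions [Q]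
     and [P] are nonzero. *)
  have -> : a = b * v by rewrite vE mulrC divfK.
  by apply: (idealM ip) => //; apply: DV.
have a0 : a != 0 by apply: contraNneq v0 => e; rewrite vE e mul0r.
have [|g [gV hg]] := schain_witnesses (V := V) _ Cl.
  by move: Fl; apply: List.Forall_impl => q [iq _] x; apply: (ideal_sub iq).
pose T := generated_algebra D g.
have rT : subring T by exact: generated_algebra_subring.
have TV : subs T V by exact: generated_algebra_sub.
have DT : subs D T by exact: generated_algebra_incl.
pose Q x := T x /\ p x; pose P x := D x /\ Q x.
have pQ : prime_of T Q by exact: (prime_restrict pp).
have iP : ideal_of D P.
  have iQ : ideal_of T Q by case: pQ.
  split; first by move=> x [].
  split; first by split; [exact: subring0 | exact: (ideal0 iQ)].
  split=> [x y [Dx Qx] [Dy Qy] | r x Dr [Dx Qx]].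
    by split; [exact: subringD | exact: (idealD iQ)].
  by split; [exact: subringM | apply: (idealM iQ) => //; apply: DT].
have Pa : P a by split=> //; split=> //; apply: DT.
(* The extension of [P] to [V] stays inside [p], which keeps 1 out of [stilde D star P]. *)
have nPV : ~ prodset P V 1.
  move=> h; apply: (prime_notin1 pp); move: h; apply: prodset_ind.
  - exact: (ideal0 ip).
  - by move=> x y; apply: (idealD ip).
  - by move=> x y [_ [_ px]] Vy; rewrite mulrC; apply: (idealM ip).
have ssP : ssubs (stilde D star P) (stilde D star D).
  split; first by apply: stilde_mono => x [].
  exists 1; split; first by apply: stilde_incl => //; exact: subring1.
  by apply: (stilde_val_center rD sstar starV iP) => //; exists a.
have [F [rho [rhoDM rho1 rho_surj rho0]]] :=
  residue_field (LocalRing (loc_subring rT pQ) (locid_ideal rT pQ)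
    (locid_notin1 pQ) (@loc_inv _ T Q)).
have nzQ : exists x, Q x /\ x != 0 by exists a; split=> //; case: Pa.
(* The formula is used with [L] equal to [K]: height at least [m.+1] and residual transcendence
   degree at least 0 on the left, bounds [n] and 0 on the right. *)
have := ineq K idfun g Q pQ nzQ ssP F rho rhoDM rho1 rho_surj rho0 m.+1 0%N n 0%N.
rewrite !addn0; apply.
- exists [seq (fun x => T x /\ q x) | q <- l]; rewrite size_map sl; split=> //; split.
    apply: Forall_seq_map; move: Fl'; apply: List.Forall_impl => q pq.
    exact: (prime_restrict pq).
  have := hg T (fun x => @generated_algebra_gen _ D g rD x).
  by rewrite map_rcons.
- by exists [::]; do !split=> //; exact: alg_indep_nil.
(* A chain ending at [P] is in particular one of those bounded by [n]. *)
- by move=> k [ls [h1 [h2 [h3 _]]]]; apply: UBn; exists ls.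
- move=> k [xs [<- [_ ind]]]; rewrite leqn0; apply/eqP; apply: (alg_indep_full _ ind).
  by move=> x; exists x.
Qed.

(** The nonunits of the lifted [V] contract to the last quasi-prime, which lies in some
    quasi-maximal [M]. Elements of [D] outside [M] are thus units of [V], so [V] contains [D_M] and
    [F V] contains [stilde D star F]. *)
Lemma star_dim_chain_dimv n : star_dim_chain D (stilde D star) n ->
  star_dimv_chain D (stilde D star) n.
Proof.
move=> [l [sl [Fl Cl]]].
have [|V [ls [vV DV sls [Fls Cls] mD]]] := valuation_chain rD _ Cl.
  by move: Fl; apply: List.Forall_impl => q [].
have [rV valV] := vV.
exists V; split; last by exists (rcons ls (nonunits V)); rewrite size_rcons sls sl.
split=> // F fF x Fx.
have Vinv b : D b -> ~ last (@zeroset K) l b -> V b^-1.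
  move=> Db nb; have Vb := DV _ Db.
  by have /(nonunitsP Vb)[] : ~ nonunits V b by move/(mD b Db).
(* For the empty chain all nonzero elements of [D] are invertible in [V], so [V] is all of [K] and
   any nonzero [f] in [F] generates everything. *)
case/lastP: l Fl Vinv {sl sls Cl mD} => [_ Vinv | l P /Forall_rcons[_ qP] Vinv].
  have [_ [_ [_ [f [Ff f0]]]]] := fin_frac_submod rD fF.
  rewrite -(divfK f0 x) mulrC; apply: prodsetM => //.
  have [a [b [Da [Db [b0 ->]]]]] := hD.2 (x / f).
  by apply: subringM => //; [exact: DV | apply: Vinv => //; apply/eqP].
have [M qM PM] := qprime_stilde_sub_qmax rD sstar qP.
move: (Fx M qM); apply: prodsetS => // _ [a [b [Da [Db [nb ->]]]]].
apply: subringM => //; first exact: DV.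
by apply: Vinv => //; rewrite last_rcons => /PM.
Qed.

End Dimension.

(** A nonempty bounded set of naturals has a largest element; being attained is what lets the
    dimension be transferred as a chain length. *)
Lemma isUB_attained (S : nat -> Prop) : S 0%N -> (exists n, isUB S n) ->
  exists n, S n /\ isUB S n.
Proof.
move=> S0 [N UBN]; have ex : exists n, `[< S n >] by exists 0%N; apply/asboolP.
have [|n /asboolP Sn nmax] := @ex_maxnP (fun n => `[< S n >]) N ex.
  by move=> i /asboolP; apply: UBN.
by exists n; split=> // m Sm; apply: nmax; apply/asboolP.
Qed.

Theorem theorem2p6 (K : fieldType) (D : K -> Prop)
  (star : (K -> Prop) -> (K -> Prop)) :
  domain_with_qf D ->
  semistar D star ->
  (exists n, isUB (star_dim_chain D (stilde D star)) n) ->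
  DInequality D star ->
  star_Jaffard D (stilde D star).
Proof.
move=> hD sstar bounded ineq.
(* The value [n] is both a member and an upper bound of each of the two sets of chain lengths, hence
   the supremum of both. *)
have [|n [Sn UBn]] := isUB_attained _ bounded.
  by exists [::]; do !split=> //.
exists n; split; first by split=> // k; apply.
split; first by move=> m; apply: star_dimv_le.
by move=> k; apply; apply: star_dim_chain_dimv.
Qed.
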